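(* Let $\pi$ be a non-trivial (i.e. not identically zero) $1$-homogeneous Poisson structure on $\mathbb{R}^n$. Then for each weight $w$ the alternating sum $\sum_{m}(-1)^m\dim\overline{C}^{\,m}_{w}$ is $0$, i.e. the Euler characteristic of $\{\overline{H}^{\bullet}_{w}\}$ is $0$. Also, for each weight $w$ the alternating sum $\sum_m(-1)^m\dim C^{m}_{w}$ is $0$, i.e. the Euler characteristic of $\{H^{\bullet}_{w}\}$ is $0$.
   Context: A Poisson structure $\pi=\frac12\sum_{i,j}p_{ij}\,\partial_i\wedge\partial_j$ ($p_{ij}=-p_{ji}$) on $\mathbb{R}^n$ is $h$-homogeneous if every $p_{ij}=\{x_i,x_j\}$ is a homogeneous polynomial of degree $h$; here $h=1$. The polynomial ring $\mathbb{R}[x_1,\dots,x_n]$ is a Lie algebra under the Poisson bracket. Let $\overline{S}_j$ be the space of homogeneous polynomials of degree $j$ and $\overline{\mathfrak S}_j$ its dual. A polynomial $f$ is a Casimir polynomial if $\{f,g\}=0$ for all polynomials $g$; let $\mathrm{Cas}_j\subset\overline{S}_j$ be the space of Casimir polynomials homogeneous of degree $j$, and let $\mathfrak S_j=\{\sigma\in\overline{\mathfrak S}_j : \langle\sigma,\mathrm{Cas}_j\rangle=0\}$, which is the dual of $\overline{S}_j/\mathrm{Cas}_j$. $\overline{\mathfrak g}=\mathbb{R}[x_1,\dots,x_n]/\mathbb{R}$ (polynomials modulo constants), and $\mathfrak g$ is the quotient of $\mathbb{R}[x_1,\dots,x_n]$ by the ideal of all Casimir polynomials (the Lie algebra of Hamiltonian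 vector fields with polynomial potentials). Their $m$-th cochain spaces of weight $w$ are $$\overline{C}^{\,m}_{w}=\bigoplus\Lambda^{k_1}\overline{\mathfrak S}_1\otimes\Lambda^{k_2}\overline{\mathfrak S}_2\otimes\cdots,\qquad C^{m}_{w}=\bigoplus\Lambda^{k_1}\mathfrak S_1\otimes\Lambda^{k_2}\mathfrak S_2\otimes\cdots,$$ where the sums are over sequences of non-negative integers $(k_1,k_2,\dots)$ with finitely many non-zero terms such that $\sum_{j\ge1}k_j=m$ and $\sum_{j\ge1}(j-2+h)k_j=w$ (with $h=1$), $m\ge 0$. The Lie algebra coboundary operators preserve the weight, and $\overline{H}^m_w$, $H^m_w$ denote the cohomology groups of $(\overline{C}^{\,\bullet}_w,\overline d)$ and $(C^\bullet_w,d)$. The Euler characteristic is the alternating sum of the dimensions of the cohomology groups over $m\ge0$. *)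

(* Defs.v *)
From HB Require Import structures.
From mathcomp Require Import all_boot all_order all_algebra.
From mathcomp Require Import boolp classical_sets functions reals.
From mathcomp Require Import mpoly.
Set Implicit Arguments.
Unset Strict Implicit.
Unset Printing Implicit Defensive.

Import Order.TTheory GRing.Theory Num.Theory.
Local Open Scope ring_scope.

Section LinearAlgebra.
Variables (R : realType) (V : lmodType R).

Definition span (G : set V) : set V :=
  fun v => exists r (a : 'I_r -> R) (g : 'I_r -> V),
    (forall i, G (g i)) /\ v = \sum_i a i *: g i.

(* dim (Z / B) = d, for subspaces B of Z: f induces an isomorphism from R^d
   onto Z / B. *)
Definition quotient_dim (Z B : set V) (d : nat) : Prop :=
  exists f : {linear 'rV[R]_d -> V},
    [/\ forall a, Z (f a),
        forall a, B (f a) -> a = 0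
      & forall z, Z z -> exists a, B (z - f a)].

Definition subspace_dim (Z : set V) : nat -> Prop :=
  quotient_dim Z (fun v => v = 0).

End LinearAlgebra.

(* All the spaces are finite-dimensional, almost all of them are zero, and
   sum_m (-1)^m dim = chi. *)
Definition alternating_sum_dim (dim : nat -> nat -> Prop) (chi : int) : Prop :=
  exists (d : nat -> nat) (N : nat),
    [/\ forall m, dim m (d m),
        forall m, (N <= m)%N -> d m = 0%N
      & \sum_(m < N) (-1) ^+ m * (d m)%:Z = chi].

Section Poisson.
Variables (R : realType) (n : nat).
Local Notation A := {mpoly R[n]}.

(* The bracket of pi = 1/2 sum_ij p_ij d_i /\ d_j. *)
Definition bracket (p : 'I_n -> 'I_n -> A) (f g : A) : A :=
  \sum_i \sum_j p i j * f^`M(i) * g^`M(j).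

Definition poisson_structure (p : 'I_n -> 'I_n -> A) : Prop :=
  (forall i j, p i j = - p j i) /\
  (forall f g k, bracket p f (bracket p g k) + bracket p g (bracket p k f)
                 + bracket p k (bracket p f g) = 0).

Definition homogeneous_structure (h : nat) (p : 'I_n -> 'I_n -> A) : Prop :=
  forall i j, p i j \is h.-homog.

Definition nontrivial_structure (p : 'I_n -> 'I_n -> A) : Prop :=
  exists i j, p i j != 0.

Definition casimir (p : 'I_n -> 'I_n -> A) : set A :=
  fun f => forall g, bracket p f g = 0.

(* The dual of the space of homogeneous polynomials of degree j: its elements
   are extended by 0 to the homogeneous polynomials of the other degrees. *)
Definition graded_dual (j : nat) : set {scalar A} :=
  fun s => forall i f, i != j -> f \is i.-homog -> s f = 0.

Definition reduced_dual (p : 'I_n -> 'I_n -> A) (j : nat) : set {scalar A} :=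
  fun s => graded_dual j s /\
    forall f, f \is j.-homog -> casimir p f -> s f = 0.

(* Cochains on a quotient of A are identified with their pullbacks to A. *)
Definition form (m : nat) : lmodType R := ('I_m -> A) -> R^o.

Definition wedge m (s : 'I_m -> {scalar A}) : form m :=
  fun f => \det (\matrix_(i, j) s i (f j)).

(* k is a sequence (k_1, k_2, ...) with finitely many nonzero terms (and a
   dummy term k_0 = 0) such that sum_j k_j = m and sum_j (j-2+h) k_j = w. *)
Definition admissible (h m : nat) (w : int) (k : nat -> nat) : Prop :=
  k 0%N = 0%N /\
  exists N : nat,
    [/\ forall j, (N <= j)%N -> k j = 0%N,
        (\sum_(1 <= j < N) k j)%N = m
      & \sum_(1 <= j < N) (j%:Z - 2 + h%:Z) * (k j)%:Z = w].

(* Generators of the image of Lambda^k_1 T_1 (x) Lambda^k_2 T_2 (x) ... in the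
   alternating m-forms under the (injective) wedge product. *)
Definition block (T : nat -> set {scalar A}) (k : nat -> nat) m :
    set (form m) :=
  fun c => exists (e : 'I_m -> nat) (s : 'I_m -> {scalar A}),
    [/\ forall j, #|[set i | e i == j]%SET| = k j,
        forall i, T (e i) (s i)
      & c = wedge s].

Definition cochains (T : nat -> set {scalar A}) (h m : nat) (w : int) :
    set (form m) :=
  span (fun c => exists2 k, admissible h m w k & block T k c).

(* The arguments ({f_i, f_j}, f_0, ..., f_(m+1)) where, for i < j, f_i and f_j
   are omitted from the tail. *)
Definition contract (p : 'I_n -> 'I_n -> A) m (f : 'I_m.+2 -> A)
    (i j : 'I_m.+2) : 'I_m.+1 -> A :=
  fun k => if unlift ord0 k is Some l then f (inord (bump j (bump i l)))
           else bracket p (f i) (f j).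

(* The Chevalley-Eilenberg coboundary with trivial coefficients. *)
Definition coboundary (p : 'I_n -> 'I_n -> A) m : form m -> form m.+1 :=
  match m with
  | 0 => fun _ => 0
  | m'.+1 => fun c f =>
      \sum_(i < m'.+2) \sum_(j < m'.+2 | (i < j)%N)
        (-1) ^+ (i + j) * c (contract p f i j)
  end.

Definition cocycles p (T : nat -> set {scalar A}) (h m : nat) (w : int) :
    set (form m) :=
  fun c => cochains T h w c /\ coboundary p c = 0.

Definition coboundaries p (T : nat -> set {scalar A}) (h m : nat) (w : int) :
    set (form m) :=
  match m with
  | 0 => fun c => c = 0
  | m'.+1 => fun c => exists2 b : form m', cochains T h w b & c = coboundary p b
  end.

Definition cochain_dim (T : nat -> set {scalar A}) (h : nat) (w : int)
    (m : nat) : nat -> Prop :=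
  subspace_dim (@cochains T h m w).

Definition cohomology_dim p (T : nat -> set {scalar A}) (h : nat) (w : int)
    (m : nat) : nat -> Prop :=
  quotient_dim (@cocycles p T h m w) (@coboundaries p T h m w).

End Poisson.

(* Main.v *)
Require Import Defs.
From HB Require Import structures.
From mathcomp Require Import all_boot all_order all_algebra.
From mathcomp Require Import boolp classical_sets functions reals.
From mathcomp Require Import mpoly zify ring.
Set Implicit Arguments.
Unset Strict Implicit.
Unset Printing Implicit Defensive.
Import Order.TTheory GRing.Theory Num.Theory.
Local Open Scope ring_scope.

(** The weight of a homogeneous polynomial of degree [j] is [j - 1], so the
linear forms have weight zero, and this is the source of both cancellations.
Pick a functional [e] on the linear polynomials that belongs to the given
family of duals and a linear polynomial [x] with [e x = 1]; in the reduced case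
this is possible because a nonzero [p i j = {x_i, x_j}] shows that [x_i] is not
a Casimir.  Exterior multiplication by [e] preserves the weight, squares to
zero, and the contraction by [x] is a contracting homotopy for it:
[i_x (e /\ c) + e /\ i_x c = c].  Hence the cochains of a fixed weight form an
acyclic complex under [e /\ _], and the alternating sum of their dimensions
vanishes ([exterior_acyclic]).  The same Euler-Poincare principle
([euler_poincare]), applied to the coboundary, transfers this to cohomology.

To run this argument one needs that the cochain spaces are finite-dimensional,
almost all zero, and that the coboundary maps cochains to cochains of the same
weight and squares to zero.  All of it rests on contraction.  A form is
determined by its contractions, and exterior products, Lie derivatives and the
coboundary are governed by their commutation with contraction (Cartan calculus,
[ins_coboundary] and [ins_lie]); the identities between them follow by
induction on the degree.  The cochains of weight [w], defined as the span of
wedge products, are characterized intrinsically ([cochainsP]) as the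
alternating multilinear forms that obey a weight condition and vanish on
central arguments, a description that is visibly stable under the coboundary.
The converse half of the characterization is Euler's identity
[sum_t tau_t /\ i_(v_t) c = m c] for dual bases [tau], [v] ([framed_euler]).

Both parts of the theorem are instances of one statement relative to a
subspace [K] of the Casimirs, [K = 0] and [K] the space of all Casimirs
([relative_euler_characteristic]). *)

(** * Dimensions of subspaces and subquotients *)

Section FiniteDimension.
Variables (R : realType) (V : lmodType R).

Definition subspace (U : set V) : Prop :=
  U 0 /\ forall a x y, U x -> U y -> U (a *: x + y).

Lemma subspaceZ U a x : subspace U -> U x -> U (a *: x).
Proof. by move=> [U0 UZD] Ux; rewrite -[_ *: _]addr0; apply: UZD. Qed.

Lemma subspaceD U x y : subspace U -> U x -> U y -> U (x + y).
Proof. by move=> [_ UZD] Ux Uy; rewrite -[x]scale1r; apply: UZD. Qed.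

Lemma subspaceB U x y : subspace U -> U x -> U y -> U (x - y).
Proof.
by move=> sU Ux Uy; apply: subspaceD => //; rewrite -scaleN1r; apply: subspaceZ.
Qed.

Lemma subspace_sum U (I : Type) (r : seq I) (P : pred I) (F : I -> V) :
  subspace U -> (forall i, P i -> U (F i)) -> U (\sum_(i <- r | P i) F i).
Proof.
by move=> sU UF; apply: (big_ind U); [case: sU | move=> x y; exact: subspaceD |].
Qed.

Lemma span_subspace (G : set V) : subspace (Defs.span G).
Proof.
split; first by exists 0%N, (fun=> 0), (fun=> 0); split=> [[]//|]; rewrite big_ord0.
move=> b x y [r [a [g [Gg ->]]]] [r' [a' [g' [Gg' ->]]]].
exists (r + r')%N,
  (fun i => match fintype.split i with inl j => b * a j | inr j => a' j end),
  (fun i => match fintype.split i with inl j => g j | inr j => g' j end).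
split=> [i|]; first by case: fintype.split.
rewrite big_split_ord /= scaler_sumr; congr (_ + _); apply: eq_bigr => i _.
  by rewrite (unsplitK (inl _ i)) scalerA.
by rewrite (unsplitK (inr _ i)).
Qed.

Lemma span_gen (G : set V) x : G x -> Defs.span G x.
Proof.
move=> Gx; exists 1%N, (fun=> 1), (fun=> x); split=> //.
by rewrite big_ord1 scale1r.
Qed.

Lemma span_sub (G U : set V) : subspace U -> (forall x, G x -> U x) ->
  forall x, Defs.span G x -> U x.
Proof.
move=> sU GU x [r [a [g [Gg ->]]]]; apply: subspace_sum => // i _.
by apply: subspaceZ => //; apply: GU.
Qed.

Lemma linear_pack (W W' : lmodType R) (f : W -> W') :
  linear f -> exists g : {linear W -> W'}, forall x, g x = f x.
Proof.
move=> lin_f; pose g : {linear W -> W'} :=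
  HB.pack f (GRing.isLinear.Build _ _ _ _ f lin_f).
by exists g.
Qed.

(** A linear map that embeds [Z] in coordinate space bounds the size of a
family in [Z] independent modulo [B]; a family of maximal size then spans [Z]
modulo [B]. *)
Lemma quotient_dim_exists (N : nat) (ev : V -> 'rV[R]_N) (Z B : set V) :
  linear ev -> subspace Z -> subspace B ->
  (forall z, Z z -> ev z = 0 -> z = 0) -> exists d, quotient_dim Z B d.
Proof.
move=> /linear_pack[E evE] sZ sB inj.
pose P d := `[< exists f : {linear 'rV[R]_d -> V},
  (forall a, Z (f a)) /\ (forall a, B (f a) -> a = 0) >].
have P0 : exists d, P d.
  exists 0%N; apply/asboolP; exists \0; split=> a; first by case: sZ.
  by move=> _; apply/rowP; case.
have Pb d : P d -> (d <= N)%N.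
  case/asboolP=> f [Zf Bf].
  pose g : {linear 'rV_d -> 'rV_N} := E \o f.
  have : row_free (lin1_mx g).
    apply/inj_row_free => v; rewrite mul_rV_lin1 /= => E0.
    by apply: Bf; rewrite (inj (f v)) -?evE //; case: sB.
  by rewrite /row_free => /eqP <-; apply: rank_leq_col.
have [d /asboolP[f [Zf Bf]] dmax] := ex_maxnP P0 Pb.
exists d, f; split=> // z Zz; apply: contrapT => noa.
suff /dmax : P d.+1 by rewrite ltnn.
have lin_g : linear (fun a : 'rV_(1 + d) => lsubmx a 0 0 *: z + f (rsubmx a)).
  move=> k x y; rewrite !linearP !mxE /=. rewrite scalerDl -scalerA .
  by rewrite addrACA scalerA mulrC -scalerA.
have [g gE] := linear_pack lin_g.
apply/asboolP; exists g; split=> a; rewrite gE.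
  by apply: subspaceD => //; apply: subspaceZ.
move=> Ba; have [a0|a0] := eqVneq (@lsubmx _ 1 1 d a 0 0) 0.
  move: Ba; rewrite a0 scale0r add0r => /Bf ra.
  rewrite -[a](@hsubmxK _ 1 1 d) ra (_ : @lsubmx _ 1 1 d a = 0) ?row_mx0 //.
  by apply/rowP=> i; rewrite ord1 a0 mxE.
(* The coefficient of z is nonzero, so z lies in the span of f modulo B. *)
case: noa; exists (- (@lsubmx _ 1 1 d a 0 0)^-1 *: @rsubmx _ 1 1 d a).
rewrite linearZ /= scaleNr opprK.
have := subspaceZ (@lsubmx _ 1 1 d a 0 0)^-1 sB Ba.
by rewrite scalerDr scalerA mulVf // scale1r.
Qed.

Lemma quotient_dim_eq0 (Z : set V) d :
  Z 0 -> quotient_dim Z Z d -> d = 0%N.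
Proof.
case: d => // d Z0 [f [Zf Bf _]].
by have /rowP/(_ 0)/eqP := Bf _ (Zf (const_mx 1)); rewrite !mxE oner_eq0.
Qed.

(** In coordinates a subquotient is a pair of row spaces [I <= K], and a
complement of [I] in [K] gives a basis of it. *)
Lemma quotient_dim_mx (Z B : set V) d k l (phi : {linear 'rV[R]_d -> V})
    (K : 'M[R]_(k, d)) (I : 'M[R]_(l, d)) :
  (forall a, phi a = 0 -> a = 0) -> (I <= K)%MS ->
  (forall z, Z z <-> exists2 a, (a <= K)%MS & z = phi a) ->
  (forall z, B z <-> exists2 a, (a <= I)%MS & z = phi a) ->
  quotient_dim Z B (\rank K - \rank I).
Proof.
move=> inj IK ZE BE.
have rkX : (\rank K - \rank I)%N = \rank (K :\: I)%MS.
  rewrite -(mxrank_cap_compl K I).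
  by have /eqmxP/eqmx_rank := capmx_idPr IK => ->; rewrite addKn.
have inj' a b : phi a = phi b -> a = b.
  by move=> /eqP; rewrite -subr_eq0 -linearB => /eqP/inj/eqP; rewrite subr_eq0 => /eqP.
rewrite rkX; set X := (K :\: I)%MS.
pose f : {linear 'rV[R]_(\rank X) -> V} := phi \o mulmxr (row_base X).
have fX (a : 'rV_(\rank X)) : (a *m row_base X <= X)%MS.
  by rewrite (submx_trans (submxMl _ _)) // eq_row_base.
exists f; split=> [a|a|z].
- apply/ZE; exists (a *m row_base X) => //.
  by rewrite (submx_trans (fX a)) // diffmxSl.
- move/BE => [b bI] /inj' /= Eb.
  have : (b <= X :&: I)%MS by rewrite sub_capmx bI -Eb fX.
  rewrite capmx_diff submx0 -Eb => /eqP E0.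
  have /row_free_inj : row_free (row_base X) by apply: row_base_free.
  by apply; rewrite E0 mul0mx.
- move/ZE => [a aK ->].
  have : (a <= X + K :&: I)%MS by rewrite addsmx_diff_cap_eq.
  case/sub_addsmxP => -[u v] /= Ea.
  have /submxP[b Eb] : (u *m X <= row_base X)%MS.
    by rewrite eq_row_base submxMl.
  exists b; apply/BE; exists (v *m (K :&: I)%MS).
    by rewrite (submx_trans (submxMl _ _)) // capmxSr.
  by rewrite -linearB -Eb Ea addrC addKr.
Qed.

End FiniteDimension.

(** * The Euler-Poincare principle *)

Section EulerPoincare.
Variables (R : realType) (V : nat -> lmodType R).
Variables (C : forall m, set (V m)) (delta : forall m, V m -> V m.+1).

Definition complex_cocycles m : set (V m) := fun c => C c /\ delta c = 0.

Definition complex_coboundaries m : set (V m) :=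
  match m with
  | 0 => fun c => c = 0
  | m'.+1 => fun c => exists2 b : V m', C b & c = delta b
  end.

Hypothesis lin_delta : forall m, linear (@delta m).
Hypothesis C_delta : forall m (c : V m), C c -> C (delta c).
Hypothesis delta_delta : forall m (c : V m), C c -> delta (delta c) = 0.

(** Choosing bases turns the complex into matrices [M m]; rank-nullity splits
each [d m] as the dimension of the cohomology plus the ranks of the outgoing
and the incoming map, and the ranks telescope. *)
Lemma euler_poincare (d : nat -> nat) (N : nat) :
  (forall m, subspace_dim (@C m) (d m)) ->
  (forall m, (N <= m)%N -> d m = 0%N) ->
  exists h : nat -> nat,
    [/\ forall m, quotient_dim (@complex_cocycles m) (@complex_coboundaries m) (h m),
        forall m, (N <= m)%N -> h m = 0%N
      & \sum_(m < N) (-1) ^+ m * (h m)%:Z = \sum_(m < N) (-1) ^+ m * (d m)%:Z].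
Proof.
move=> dimC d0.
pose phi m := projT1 (cid (dimC m)).
have phiC m a : C (phi m a) by rewrite /phi; case: cid => f [].
have phi_inj m a : phi m a = 0 -> a = 0.
  by rewrite /phi; case: cid => f /= [_ inj _]; apply: inj.
have phi_surj m z : C z -> exists a, z = phi m a.
  rewrite /phi; case: cid => f /= [_ _ surj] /surj[a] /eqP.
  by rewrite subr_eq0 => /eqP ->; exists a.
have phi_inj' m a b : phi m a = phi m b -> a = b.
  move/eqP; rewrite -subr_eq0 -linearB => /eqP/phi_inj/eqP.
  by rewrite subr_eq0 => /eqP.
have matrixE m : exists M : 'M[R]_(d m, d m.+1),
    forall a, phi m.+1 (a *m M) = delta (phi m a).
  have /choice[r rE] : forall i : 'I_(d m), exists r,
      delta (phi m (delta_mx 0 i)) = phi m.+1 r.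
    by move=> i; apply: phi_surj; apply: C_delta.
  exists (\matrix_i r i) => a.
  have [D DE] := linear_pack (@lin_delta m).
  rewrite mulmx_sum_row linear_sum -DE {2}(row_sum_delta a) !linear_sum.
  apply: eq_bigr => i _.
  by rewrite rowK !linearZ /= DE rE.
pose M m := projT1 (cid (matrixE m)).
have ME m a : phi m.+1 (a *m M m) = delta (phi m a) by rewrite /M; case: cid.
(* The coboundaries in degree m, a row space of width d m. *)
pose cob m : 'M[R]_(d m) := if m is m'.+1 then <<M m'>>%MS else 0.
pose rk m := \rank (cob m).
have rkM m : \rank (M m) = rk m.+1 by rewrite /rk /cob mxrank_gen.
have cob_ker m : (cob m <= kermx (M m))%MS.
  case: m => [|m]; first by rewrite sub0mx.
  rewrite /cob genmxE; apply/rV_subP => v /submxP[a ->]; apply/sub_kermxP.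
  by apply: phi_inj; rewrite !ME delta_delta.
exists (fun m => (\rank (kermx (M m)) - rk m)%N).
have dE m : d m = (\rank (kermx (M m)) - rk m + rk m + rk m.+1)%N.
  by rewrite subnK ?mxrankS ?cob_ker // mxrank_ker rkM subnK // -rkM rank_leq_row.
split=> [m|m /d0 dm0|].
- apply: quotient_dim_mx (phi m) _ _ (phi_inj m) (cob_ker m) _ _ => z.
    split=> [[Cz dz]|[a /sub_kermxP aM ->]]; last by rewrite /complex_cocycles -ME aM linear0.
    have [a za] := phi_surj _ _ Cz; exists a => //; apply/sub_kermxP.
    by apply: phi_inj; rewrite ME -za.
  case: m z => [|m] z /=.
    split=> [->|[a]]; first by exists 0; rewrite ?linear0 ?sub0mx.
    by rewrite submx0 => /eqP -> ->; rewrite linear0.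
  split=> [[b /phi_surj[a ->] ->]|[a]].
    by exists (a *m M m); rewrite ?ME // genmxE submxMl.
  by rewrite genmxE => /submxP[b ->] ->; exists (phi m b); rewrite // ME.
- by apply/eqP; rewrite -leqn0 -[leqRHS]dm0 [leqRHS]dE -addnA leq_addr.
have tele n : \sum_(m < n) (-1) ^+ m * (d m)%:Z =
    \sum_(m < n) (-1) ^+ m * (\rank (kermx (M m)) - rk m)%N%:Z
      - (-1) ^+ n * (rk n)%:Z.
  elim: n => [|n IH]; first by rewrite !big_ord0 /rk mxrank0 mulr0 subr0.
  rewrite !big_ord_recr /= IH [in LHS](dE n) !PoszD exprS mulN1r !mulrDr !mulNr.
  by rewrite opprK; ring.
rewrite tele (_ : rk N = 0%N) ?mulr0 ?subr0 //.
by apply/eqP; rewrite -leqn0 -[leqRHS](d0 N (leqnn N)) rank_leq_row.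
Qed.

End EulerPoincare.

(** * Alternating forms, contraction and the Cartan formula *)

Section Cons.
Variable T : Type.

Definition fcons m (x : T) (f : 'I_m -> T) : 'I_m.+1 -> T :=
  fun k => if unlift ord0 k is Some l then f l else x.

Definition ftail m (f : 'I_m.+1 -> T) : 'I_m -> T := fun i => f (lift ord0 i).

Lemma fcons0 m x (f : 'I_m -> T) : fcons x f ord0 = x.
Proof. by rewrite /fcons unlift_none. Qed.

Lemma fconsS m x (f : 'I_m -> T) i : fcons x f (lift ord0 i) = f i.
Proof. by rewrite /fcons liftK. Qed.

Lemma ftail_fcons m x (f : 'I_m -> T) : ftail (fcons x f) = f.
Proof. by apply/funext => i; rewrite /ftail fconsS. Qed.

Lemma fcons_ftail m (f : 'I_m.+1 -> T) : fcons (f ord0) (ftail f) = f.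
Proof.
by apply/funext => i; case: (unliftP ord0 i) => [j|] ->; rewrite ?fcons0 ?fconsS.
Qed.

Lemma fcons_lift0 m x (f : 'I_m -> T) : (fun k => fcons x f (lift ord0 k)) = f.
Proof. exact: ftail_fcons. Qed.

Lemma fcons_liftS m x (f : 'I_m.+1 -> T) j :
  (fun k => fcons x f (lift (lift ord0 j) k)) = fcons x (fun k => f (lift j k)).
Proof.
apply/funext => k; case: (unliftP ord0 k) => [l|] ->.
  rewrite fconsS (_ : lift (lift ord0 j) (lift ord0 l) = lift ord0 (lift j l)) ?fconsS //.
  by apply/val_inj; rewrite /= /bump /= !add1n ltnS addnS.
by rewrite fcons0 (_ : lift (lift ord0 j) ord0 = ord0) ?fcons0 //; apply/val_inj.
Qed.

End Cons.

Section Forms.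
Variables (R : realType) (n : nat).
Local Notation A := {mpoly R[n]}.
Local Notation form := (Defs.form R n).

Definition ins (x : A) {m} (c : form m.+1) : form m := fun f => c (fcons x f).

Lemma ins_is_linear x m : linear (ins x (m := m)).
Proof. by []. Qed.

HB.instance Definition _ x m :=
  GRing.isLinear.Build R (form m.+1) (form m) _ (@ins x m) (@ins_is_linear x m).

Lemma insD x m (c c' : form m.+1) : ins x (c + c') = ins x c + ins x c'.
Proof. by []. Qed.

Lemma insN x m (c : form m.+1) : ins x (- c) = - ins x c.
Proof. by []. Qed.

Lemma form_ins_ext m (c c' : form m.+1) : (forall x, ins x c = ins x c') -> c = c'.
Proof.
move=> E; apply/funext => f; rewrite -(fcons_ftail f).
exact: (congr1 (fun b : form m => b (ftail f)) (E (f ord0))).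
Qed.

Lemma form0_ext (f g : 'I_0 -> A) : f = g.
Proof. by apply/funext; case. Qed.

Lemma formZD m a (c c' : form m) f : (a *: c + c') f = a * c f + c' f.
Proof. by []. Qed.

Lemma formN m (c : form m) f : (- c) f = - c f.
Proof. by []. Qed.

(** Vanishing when the first two arguments agree.  Imposed on all iterated
contractions this amounts to full alternation, and it is the only form in which
alternation enters the inductions on the degree. *)
Definition alternating0 {m} : form m.+1 -> Prop :=
  match m with
  | 0 => fun=> True
  | m'.+1 => fun c : form m'.+2 => forall x, ins x (ins x c) = 0
  end.

Fixpoint altml {m} : form m -> Prop :=
  match m with
  | 0 => fun=> True
  | m'.+1 => fun c : form m'.+1 =>
      [/\ linear (fun x : A => ins x c), alternating0 c & forall x, altml (ins x c)]
  end.

Lemma altml_ins m (c : form m.+1) x : altml c -> altml (ins x c).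
Proof. by case=> _ _; apply. Qed.

Lemma altml_insins m (c : form m.+2) x : altml c -> ins x (ins x c) = 0.
Proof. by case=> _ + _; apply. Qed.

Lemma altml_linear m (c : form m.+1) :
  altml c -> exists g : {linear A -> form m}, forall x, ins x c = g x.
Proof. by case=> /linear_pack[g gE] _ _; exists g. Qed.

Lemma altml_insD m (c : form m.+1) x y : altml c -> ins (x + y) c = ins x c + ins y c.
Proof. by move/altml_linear => [g gE]; rewrite !gE linearD. Qed.

Lemma altml_insN m (c : form m.+1) x : altml c -> ins (- x) c = - ins x c.
Proof. by move/altml_linear => [g gE]; rewrite !gE linearN. Qed.

Lemma altml_ins0 m (c : form m.+1) : altml c -> ins 0 c = 0.
Proof. by move/altml_linear => [g gE]; rewrite !gE linear0. Qed.

Lemma altml_swap m (c : form m.+2) x y :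
  altml c -> ins x (ins y c) = - ins y (ins x c).
Proof.
move=> cA; apply/eqP; rewrite -addr_eq0; apply/eqP.
have := altml_insins (x + y) cA.
rewrite (altml_insD _ _ cA) linearD /= !altml_insD ?altml_insins //; try exact: altml_ins.
by rewrite add0r addr0 addrC.
Qed.

Lemma altml_subspace m : subspace (@altml m).
Proof.
elim: m => [|m [IH0 IH]]; first by [].
have aS x a (c c' : form m.+1) : ins x (a *: c + c') = a *: ins x c + ins x c'.
  by rewrite linearP.
split.
  split=> [a x y|| x]; first by rewrite scaler0 addr0.
    by case: m {IH0 IH aS}.
  exact: IH0.
move=> a c c' [lc ac cA] [lc' ac' cA']; split=> [b x y||x].
- by rewrite !aS lc lc' !scalerDr !scalerA (mulrC a) addrACA.
- case: m c c' ac ac' {lc lc' cA cA' IH0 IH aS} => //= m c c' ac ac' x.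
  by rewrite !linearP /= ac ac' scaler0 addr0.
- by rewrite aS; apply: IH; [exact: cA | exact: cA'].
Qed.

Variable p : 'I_n -> 'I_n -> A.
Local Notation "{[ x , y ]}" := (bracket p x y).

Lemma bracket_linearl y : linear (bracket p ^~ y).
Proof.
move=> a f g; rewrite /bracket scaler_sumr -big_split; apply: eq_bigr => i _ /=.
rewrite scaler_sumr -big_split; apply: eq_bigr => j _ /=.
by rewrite linearP /= mulrDr mulrDl -!scalerAr -!scalerAl.
Qed.

Lemma bracket_linearr x : linear (bracket p x).
Proof.
move=> a f g; rewrite /bracket scaler_sumr -big_split; apply: eq_bigr => i _ /=.
rewrite scaler_sumr -big_split; apply: eq_bigr => j _ /=.
by rewrite linearP /= mulrDr -!scalerAr.
Qed.

(** [lie x c] is the sum over the slots of [c] of the result of replacing the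
argument [y] in this slot by [{x, y}], that is, minus the coadjoint action; the
recursion makes its commutation with contraction immediate. *)
Fixpoint lie (x : A) {m} : form m -> form m :=
  match m with
  | 0 => fun=> 0
  | m'.+1 => fun (c : form m'.+1) f =>
      ins {[x, f ord0]} c (ftail f) + lie x (ins (f ord0) c) (ftail f)
  end.

Arguments lie : simpl never.

Lemma ins_lie x y m (c : form m.+1) :
  ins y (lie x c) = ins {[x, y]} c + lie x (ins y c).
Proof. by apply/funext => f; rewrite /ins [LHS]/lie /ins fcons0 ftail_fcons. Qed.

Lemma lie_is_linear x m : linear (@lie x m).
Proof.
elim: m => [|m IH] a c c'; first by rewrite /lie scaler0 addr0.
apply: form_ins_ext => y.
by rewrite ins_lie !ins_is_linear !ins_lie IH scalerDr addrACA.
Qed.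

HB.instance Definition _ x m :=
  GRing.isLinear.Build R (form m) (form m) _ (@lie x m) (@lie_is_linear x m).

Lemma lie_linearl m (c : form m) : altml c -> linear (fun x => lie x c).
Proof.
elim: m c => [|m IH] c cA a x y; first by rewrite /lie scaler0 addr0.
apply: form_ins_ext => z; rewrite ins_is_linear !ins_lie (IH _ (altml_ins _ cA)).
by rewrite bracket_linearl; case: cA => -> _ _; rewrite scalerDr addrACA.
Qed.

Lemma altml_lie x m (c : form m) : altml c -> altml (lie x c).
Proof.
elim: m c => [|m IH] c cA //; split=> [a y z||y].
- rewrite !ins_lie bracket_linearr; case: (cA) => lc _ _.
  by rewrite !lc lie_is_linear scalerDr addrACA.
- case: m c cA IH => // m c cA IH y; change (ins y (ins y (lie x c)) = 0).
  rewrite ins_lie insD [ins y (lie _ _)]ins_lie (altml_insins _ cA) linear0 addr0.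
  by rewrite (altml_swap _ _ cA) addNr.
- rewrite ins_lie; apply: subspaceD; [exact: altml_subspace | exact: altml_ins |].
  by apply: IH; apply: altml_ins.
Qed.

(** Moving the bracket from the slot [j] to the front of an alternating form
costs the sign [(-1) ^ j]; in this shape the sum is, up to sign, the part of the
coboundary of [c] that involves [x] in the bracket. *)
Lemma lieE x m (c : form m.+1) f : altml c ->
  lie x c f = \sum_(j < m.+1)
    (-1) ^+ j * c (fcons {[x, f j]} (fun k => f (lift j k))).
Proof.
elim: m c f => [|m IH] c f cA.
  by rewrite big_ord1 mul1r; apply: addr0.
rewrite big_ord_recl mul1r.
rewrite -[LHS]/(c _ + lie x (ins (f ord0) c) (ftail f)); congr (_ + _).
rewrite (IH _ _ (altml_ins _ cA)); apply: eq_bigr => j _.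
have E y g : c (fcons (f ord0) (fcons y g)) = - c (fcons y (fcons (f ord0) g)).
  exact: (congr1 (fun b : form m => b g) (altml_swap y (f ord0) cA)).
rewrite /ins E lift0 exprS mulN1r mulrN mulNr; congr (- (_ * c (fcons _ _))).
by rewrite -fcons_liftS fcons_ftail.
Qed.

Lemma contract_fcons0 x m (f : 'I_m.+1 -> A) (j : 'I_m.+1) :
  contract p (fcons x f) ord0 (lift ord0 j) =
  fcons {[x, f j]} (fun k => f (lift j k)).
Proof.
apply/funext => k; rewrite /contract [RHS]/fcons.
case: (unliftP ord0 k) => [l|] _; last by rewrite fcons0 fconsS.
rewrite (_ : inord _ = lift ord0 (lift j l)) ?fconsS //; apply/val_inj.
have lt := ltn_ord (lift j l).
have E : bump (lift ord0 j) (bump (@ord0 m.+1) l) = (lift j l).+1.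
  by rewrite /= /bump /=; lia.
by apply: etrans (inordK _) _; rewrite E.
Qed.

Lemma contract_fcons x m (f : 'I_m.+2 -> A) (i j : 'I_m.+2) :
  contract p (fcons x f) (lift ord0 i) (lift ord0 j) =
  fcons {[f i, f j]} (fcons x (ftail (contract p f i j))).
Proof.
apply/funext => k; rewrite /contract /fcons.
case: (unliftP ord0 k) => [l|] _; last by rewrite !liftK.
case: (unliftP ord0 l) => [h|] ->; last first.
  by rewrite (_ : inord _ = ord0) ?unlift_none //; apply/val_inj; rewrite /= inordK.
rewrite /ftail liftK.
rewrite (_ : inord _ = lift ord0 (inord (bump j (bump i h)))) ?liftK //.
have lt : (bump j (bump i h) < m.+2)%N.
  by rewrite /bump; case: leqP; case: leqP; rewrite ?add1n ?add0n ?ltnS;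
    have := ltn_ord h; lia.
have E : bump (lift ord0 j) (bump (lift ord0 i) (lift ord0 h)) = (bump j (bump i h)).+1.
  by rewrite /= /bump /=; lia.
by apply/val_inj; rewrite E /= !inordK.
Qed.

Lemma coboundary_is_linear m : linear (@coboundary R n p m).
Proof.
case: m => [|m] a c c'; first by rewrite /= scaler0 addr0.
apply/funext => f; rewrite formZD /=.
rewrite mulr_sumr -big_split; apply: eq_bigr => i _ /=.
rewrite mulr_sumr -big_split; apply: eq_bigr => j _ /=.
by rewrite formZD mulrDr mulrCA.
Qed.

HB.instance Definition _ m :=
  GRing.isLinear.Build R (form m) (form m.+1) _ (@coboundary R n p m)
    (@coboundary_is_linear m).

(** Cartan's formula [i_x d + d i_x = L_x], as [- lie x] is the Lie derivative:
the pairs that contain the first argument contribute [- lie x c]; in the others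
the bracket and the first argument [x] are exchanged, which gives the sign. *)
Lemma ins_coboundary x m (c : form m.+1) : altml c ->
  ins x (coboundary p c) = - lie x c - coboundary p (ins x c).
Proof.
move=> cA; apply/funext => f.
rewrite {1}/ins /coboundary big_ord_recl.
congr (_ + _).
  rewrite big_mkcond big_ord_recl /= add0r formN (lieE _ _ cA) -sumrN.
  by apply: eq_bigr => j _; rewrite contract_fcons0 exprS mulN1r mulNr.
case: m c cA f => [|m] c cA f.
  rewrite big_ord1 big_mkcond big_ord_recl big_ord1 /= addr0.
  by rewrite formN oppr0.
rewrite formN -sumrN; apply: eq_bigr => i _.
rewrite big_mkcond big_ord_recl /= add0r -sumrN [RHS]big_mkcond /=.
apply: eq_bigr => j _; rewrite ltnS; case: ifP => // ij.
rewrite contract_fcons -[bump 0 i]/i.+1 -[bump 0 j]/j.+1 addSn addnS !exprS mulrA.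
rewrite mulrNN !mul1r -mulrN.
congr (_ * _).
have E g : c (fcons {[f i, f j]} (fcons x g)) = - c (fcons x (fcons {[f i, f j]} g)).
  exact: (congr1 (fun b : form m => b g) (altml_swap x {[f i, f j]} cA)).
rewrite E; congr (- c (fcons _ _)).
by rewrite -[RHS]fcons_ftail /contract unlift_none.
Qed.

Lemma lie_form0 x (c : form 0) : lie x c = 0.
Proof. by []. Qed.

Lemma coboundary_form0 (c : form 0) : coboundary p c = 0.
Proof. by []. Qed.

End Forms.

(* Otherwise unification unfolds these operators, which hides the redexes of the
   rewriting rules below. *)
Opaque lie coboundary.

(** * The coboundary squares to zero *)

Section Coboundary.
Variables (R : realType) (n : nat) (p : 'I_n -> 'I_n -> {mpoly R[n]}).
Local Notation A := {mpoly R[n]}.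
Local Notation form := (Defs.form R n).
Local Notation "{[ x , y ]}" := (bracket p x y).
Local Notation lie := (lie p).
Local Notation d := (coboundary p).
Hypothesis poisson_p : poisson_structure p.

Lemma bracketC x y : {[x, y]} = - {[y, x]}.
Proof.
case: poisson_p => pC _; rewrite /bracket exchange_big -sumrN.
apply: eq_bigr => i _; rewrite -sumrN; apply: eq_bigr => j _ /=.
by rewrite pC !mulNr; congr (- _); rewrite mulrAC.
Qed.

Lemma bracketxx x : {[x, x]} = 0.
Proof.
have : {[x, x]} *+ 2 = 0 by rewrite mulr2n {1}bracketC addNr.
rewrite -scaler_nat => /eqP; rewrite scaler_eq0 pnatr_eq0 /=.
by move/eqP.
Qed.

Lemma bracket_jacobi x y z :
  {[{[x, y]}, z]} = {[x, {[y, z]}]} - {[y, {[x, z]}]}.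
Proof.
case: poisson_p => _ /(_ x y z) /eqP; rewrite addrC addr_eq0 => /eqP.
rewrite (bracketC z) => /oppr_inj ->; congr (_ + _).
have [g gE] := linear_pack (@bracket_linearr R n p y).
by rewrite (bracketC z x) -!gE linearN.
Qed.

Lemma lieD x m (c c' : form m) : lie x (c + c') = lie x c + lie x c'.
Proof. exact: linearD. Qed.

Lemma lieN x m (c : form m) : lie x (- c) = - lie x c.
Proof. exact: linearN. Qed.

Lemma coboundaryD m (c c' : form m) : d (c + c') = d c + d c'.
Proof. exact: linearD. Qed.

Lemma coboundaryN m (c : form m) : d (- c) = - d c.
Proof. exact: linearN. Qed.

(** By induction through contraction: contracting by [z] leaves the Jacobi
identity for [x], [y], [z] in the first slot. *)
Lemma lie_bracket x y m (c : form m) : altml c ->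
  lie {[x, y]} c = lie y (lie x c) - lie x (lie y c).
Proof.
elim: m c => [|m IH] c cA; first by rewrite !lie_form0 subr0.
apply: form_ins_ext => z; have iA y' := altml_ins y' cA.
rewrite insD insN !ins_lie !lieD IH // bracket_jacobi.
rewrite altml_insD // altml_insN //.
rewrite !opprD !addrA; ring.
Qed.

(** Cartan's formula expresses both sides contracted by [y] by Lie derivatives
and by the same identity in lower degree; [lie_bracket] cancels the rest. *)
Lemma coboundary_lie x m (c : form m) : altml c -> d (lie x c) = lie x (d c).
Proof.
elim: m c => [|m IH] c cA; first by rewrite lie_form0 !coboundary_form0 linear0.
have iA y' := altml_ins y' cA.
apply: form_ins_ext => y.
rewrite (ins_coboundary _ _ (altml_lie _ _ cA)) ins_lie coboundaryD.
rewrite ins_lie !(ins_coboundary _ _ cA) (lieD x (- lie y c)) !lieN IH //.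
rewrite (lie_bracket _ _ cA) !opprD.
ring.
Qed.

(** Alternation in the first two slots follows from Cartan's formula and
[{x, x} = 0]; the other slots are handled by induction. *)
Lemma altml_coboundary m (c : form m) : altml c -> altml (d c).
Proof.
elim: m c => [|m IH] c cA; first by rewrite coboundary_form0; case: (@altml_subspace R n 1).
split=> [a x y||x].
- rewrite !ins_coboundary // (lie_linearl _ cA); case: (cA) => -> _ _.
  rewrite coboundary_is_linear scalerBr scalerN !opprD. by rewrite addrACA.
- move=> x; rewrite ins_coboundary // insD !insN ins_lie bracketxx altml_ins0 //.
  rewrite add0r.
  case: m c cA {IH} => [|m] c cA; first by rewrite lie_form0 coboundary_form0 oppr0 addr0.
  rewrite (ins_coboundary _ _ (altml_ins _ cA)) (altml_insins _ cA) linear0.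
  by rewrite subr0 opprK addNr.
- rewrite ins_coboundary //; apply: subspaceB; first exact: altml_subspace.
    rewrite -scaleN1r; apply: subspaceZ; first exact: altml_subspace.
    exact: altml_lie.
  by apply: IH; apply: altml_ins.
Qed.

(** Contracting [d (d c)] by [x] and using Cartan's formula twice leaves the
commutator of [d] with [lie x] and [d (d (ins x c))]. *)
Lemma coboundary_coboundary m (c : form m) : altml c -> d (d c) = 0.
Proof.
elim: m c => [|m IH] c cA; first by rewrite coboundary_form0 linear0.
apply: form_ins_ext => x.
have dA : altml (d c) by apply: altml_coboundary.
rewrite !ins_coboundary // coboundaryD !coboundaryN (IH _ (altml_ins _ cA)).
by rewrite coboundary_lie // oppr0 addr0 opprK addNr.
Qed.

End Coboundary.

(** * Weights *)

Section Weight.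
Variables (R : realType) (n : nat) (p : 'I_n -> 'I_n -> {mpoly R[n]}).
Local Notation A := {mpoly R[n]}.
Local Notation form := (Defs.form R n).
Local Notation "{[ x , y ]}" := (bracket p x y).
Local Notation lie := (lie p).
Local Notation d := (coboundary p).

Lemma mderiv_homog u (f : A) i : f \is u.-homog -> f^`M(i) \is u.-1.-homog.
Proof.
move=> /dhomogP hf; rewrite [f]mpolyE raddf_sum big_seq /=.
apply: rpred_sum => m /hf <-; rewrite mderivZ mderivX.
have [->|mi] := eqVneq (m i) 0%N; first by rewrite scale0r scaler0 rpred0.
have E : mdeg m = (mdeg (m - U_(i))%MM).+1.
  by rewrite -{1}(submK (m := U_(i)%MM) (m' := m)) ?lep1mP // mdegD mdeg1 addn1.
by apply/rpredZ/rpredZ; rewrite dhomogX /= E.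
Qed.

Lemma mderiv_homog0 (f : A) i : f \is 0.-homog -> f^`M(i) = 0.
Proof.
move=> /dhomogP hf; rewrite [f]mpolyE raddf_sum big_seq /=.
apply: big1 => m /hf /eqP; rewrite /= mdeg_eq0 => /eqP ->.
by rewrite mderivZ mderivX mnm0E scale0r scaler0.
Qed.

Lemma bracket_homog0 (x y : A) : x \is 0.-homog -> {[x, y]} = 0.
Proof.
move=> x0; rewrite /bracket; apply: big1 => i _; apply: big1 => j _.
by rewrite mderiv_homog0 // mulr0 mul0r.
Qed.

(** Membership conditions are only imposed on homogeneous arguments, and this
is how they determine a form on all polynomials. *)
Lemma homog_ext (V : lmodType R) (g g' : {linear A -> V}) :
  (forall u x, x \is u.-homog -> g x = g' x) -> forall x, g x = g' x.
Proof.
move=> E x; rewrite (pihomog_partitionE (mf := mdeg) (leqnn (msize x))) !linear_sum.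
by apply: eq_bigr => u _; apply: E (pihomogP _ _ _).
Qed.

Variable K : set A.
Hypothesis K_central : forall x y, K x -> {[x, y]} = 0.

(** The intrinsic weight condition: on homogeneous arguments of degrees [u_i],
the form vanishes unless the sum of the [u_i - 1] is [w], and it vanishes when an
argument is a constant or lies in [K]. *)
Fixpoint weighted (w : int) {m} : form m -> Prop :=
  match m with
  | 0 => fun c : form 0 => w <> 0 -> c = 0
  | m'.+1 => fun c : form m'.+1 => forall u x, x \is u.-homog ->
      (u = 0%N \/ K x -> ins x c = 0) /\ weighted (w - (u%:Z - 1)) (ins x c)
  end.

Lemma weighted_subspace w m : subspace (@weighted w m).
Proof.
elim: m w => [|m IH] w; split=> //.
- by move=> u c c' c0 c'0 /[dup] /c0 -> /c'0 ->; rewrite scaler0 addr0.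
- by move=> u x _; split=> //; apply: (IH _).1.
- move=> v c c' cw c'w u x xa; have [c0 cw1] := cw _ _ xa; have [c'0 c'w1] := c'w _ _ xa.
  rewrite ins_is_linear; split; last exact: (IH _).2.
  by move=> /[dup] /c0 -> /c'0 ->; rewrite scaler0 addr0.
Qed.

Lemma weighted_ins w m (c : form m.+1) u x :
  x \is u.-homog -> weighted w c -> weighted (w - (u%:Z - 1)) (ins x c).
Proof. by move=> xa /(_ _ _ xa)[]. Qed.

Lemma weighted_ins0 w m (c : form m.+1) u x :
  x \is u.-homog -> u = 0%N \/ K x -> weighted w c -> ins x c = 0.
Proof. by move=> xa x0 /(_ _ _ xa)[/(_ x0)]. Qed.

(** Constants are excluded, so every argument has nonnegative weight. *)
Lemma weighted_lt0 w m (c : form m) : altml c -> weighted w c -> w < 0 -> c = 0.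
Proof.
elim: m w c => [|m IH] w c cA cw w0; first by apply: cw => ww; rewrite ww in w0.
apply: form_ins_ext => x; have [g gE] := altml_linear cA.
rewrite gE; apply: (homog_ext (g' := \0 : {linear A -> form m})) => u {}x xa.
rewrite -gE /=; have [a0|a0] := posnP u; first by rewrite (weighted_ins0 xa _ cw) //; left.
apply: IH (altml_ins _ cA) (weighted_ins xa cw) _; lia.
Qed.

Hypothesis poisson_p : poisson_structure p.
Hypothesis linear_p : homogeneous_structure 1 p.

(** Since the structure is linear, bracketing lowers the total degree by one,
that is, it adds the weights of its arguments. *)
Lemma bracket_homog u v (x y : A) :
  x \is u.-homog -> y \is v.-homog -> {[x, y]} \is (u + v).-1.-homog.
Proof.
move=> xa yb; have [a0|a0] := posnP u.
  by move: xa; rewrite a0 => /bracket_homog0 ->; rewrite rpred0.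
have [b0|b0] := posnP v.
  by move: yb; rewrite bracketC // b0 => /bracket_homog0 ->; rewrite oppr0 rpred0.
apply: rpred_sum => i _; apply: rpred_sum => j _.
rewrite (_ : (u + v).-1 = (1 + u.-1 + v.-1)%N); last by lia.
by do !apply: dhomogM; rewrite ?mderiv_homog //; apply: linear_p.
Qed.

Lemma central_bracket u x y : x \is u.-homog -> u = 0%N \/ K x -> {[x, y]} = 0.
Proof. by move=> + [a0|/K_central //]; rewrite a0; apply: bracket_homog0. Qed.

Lemma lie_central x m (c : form m) :
  (forall y, {[x, y]} = 0) -> altml c -> lie x c = 0.
Proof.
move=> x0; elim: m c => [|m IH] c cA; first by rewrite lie_form0.
apply: form_ins_ext => y; rewrite ins_lie x0 (altml_ins0 cA) IH ?addr0 //.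
exact: altml_ins.
Qed.

Lemma weighted_lie w u x m (c : form m) :
  x \is u.-homog -> altml c -> weighted w c ->
  weighted (w - (u%:Z - 1)) (lie x c).
Proof.
move=> xa; elim: m w c => [|m IH] w c cA cw.
  by rewrite lie_form0; case: (weighted_subspace (w - (u%:Z - 1)) 0).
move=> v y yb; rewrite ins_lie; split=> [y0|].
  rewrite bracketC // (central_bracket _ yb y0) oppr0 (altml_ins0 cA).
  by rewrite (weighted_ins0 yb y0 cw) linear0 addr0.
apply: (subspaceD (weighted_subspace _ _)).
  have [ab0|ab0] := posnP (u + v)%N.
    rewrite (central_bracket (u := u)) ?(altml_ins0 cA) //; last by left; lia.
    by case: (weighted_subspace (w - (u%:Z - 1) - (v%:Z - 1)) m).
  rewrite (_ : _ - _ = w - ((u + v).-1%:Z - 1)); last by lia.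
  by apply: weighted_ins cw; apply: bracket_homog.
rewrite (_ : _ - _ = w - (v%:Z - 1) - (u%:Z - 1)); last by lia.
by apply: IH; [apply: altml_ins | apply: weighted_ins].
Qed.

Lemma weighted_coboundary w m (c : form m) :
  altml c -> weighted w c -> weighted w (d c).
Proof.
elim: m w c => [|m IH] w c cA cw.
  by rewrite coboundary_form0; case: (weighted_subspace w 1).
move=> u x xa; rewrite ins_coboundary //; split=> [x0|].
  rewrite (weighted_ins0 xa x0 cw) linear0 subr0 lie_central ?oppr0 // => y.
  exact: central_bracket xa x0.
apply: (subspaceB (weighted_subspace _ _)).
  rewrite -scaleN1r; apply: (subspaceZ _ (weighted_subspace _ _)).
  exact: weighted_lie.
by apply: IH; [apply: altml_ins | apply: weighted_ins].
Qed.

End Weight.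

(** * Exterior multiplication by a functional *)

Section Exterior.
Variables (R : realType) (n : nat).
Local Notation A := {mpoly R[n]}.
Local Notation form := (Defs.form R n).

Definition exterior (e : {scalar A}) {m} (c : form m) : form m.+1 :=
  fun f => \sum_(i < m.+1) (-1) ^+ i * e (f i) * c (fun k => f (lift i k)).

Lemma exterior_is_linear e m : linear (@exterior e m).
Proof.
move=> a c c'; apply/funext => f; rewrite formZD /exterior.
rewrite mulr_sumr -big_split; apply: eq_bigr => i _ /=.
by rewrite formZD mulrDr mulrCA.
Qed.

HB.instance Definition _ e m :=
  GRing.isLinear.Build R (form m) (form m.+1) _ (@exterior e m) (@exterior_is_linear e m).

Lemma ins_exterior0 e x (c : form 0) : ins x (exterior e c) = e x *: c.
Proof.
apply/funext => f; rewrite /ins /exterior big_ord1 expr0 mul1r fcons0.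
by congr (_ * c _); apply: form0_ext.
Qed.

(** Contraction is an antiderivation; for [e x = 1] this is the contracting
homotopy of exterior multiplication by [e]. *)
Lemma ins_exterior e x m (c : form m.+1) :
  ins x (exterior e c) = e x *: c - exterior e (ins x c).
Proof.
apply/funext => f; rewrite /ins {1}/exterior big_ord_recl expr0 mul1r fcons0.
rewrite fcons_lift0 formZD formN; congr (_ + _).
rewrite /exterior -sumrN; apply: eq_bigr => i _.
by rewrite lift0 exprS mulN1r fconsS fcons_liftS -!mulNr.
Qed.

(** Laplace expansion along the first row. *)
Lemma exterior_wedge e m (s : 'I_m -> {scalar A}) :
  exterior e (wedge s) = wedge (fcons e s).
Proof.
apply/funext => f; rewrite /exterior /wedge (expand_det_row _ ord0).
apply: eq_bigr => i _; rewrite !mxE fcons0 /cofactor add0n mulrCA mulrA.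
by congr (_ * \det _); apply/matrixP => k l; rewrite !mxE fconsS.
Qed.

(** Laplace expansion along the first column. *)
Lemma ins_wedge x m (s : 'I_m.+1 -> {scalar A}) :
  ins x (wedge s) =
  \sum_(i < m.+1) ((-1) ^+ i * s i x) *: (wedge (fun k => s (lift i k)) : form m).
Proof.
apply/funext => f; rewrite /ins /wedge (expand_det_col _ ord0).
rewrite fct_sumE; apply: eq_bigr => i _.
rewrite !mxE fcons0 /cofactor addn0 mulrCA mulrA.
by congr (_ * \det _); apply/matrixP => k l; rewrite !mxE fconsS.
Qed.

Lemma wedge_alternating m (s : 'I_m -> {scalar A}) f i j :
  i != j -> f i = f j -> wedge s f = 0.
Proof.
move=> ij fij; rewrite /wedge -det_tr; apply: (determinant_alternate ij) => k.
by rewrite !mxE fij.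
Qed.

Lemma altml_wedge m (s : 'I_m -> {scalar A}) : altml (wedge s).
Proof.
elim: m s => [//|m IH] s; split=> [a x y||x].
- rewrite !ins_wedge scaler_sumr -big_split; apply: eq_bigr => i _ /=.
  by rewrite linearP mulrDr scalerDl scalerA; congr (_ *: _ + _); rewrite mulrCA.
- case: m s {IH} => // m s x; apply/funext => f.
  apply: (@wedge_alternating _ _ _ ord0 (lift ord0 ord0)) => //.
  by rewrite fcons0 fconsS fcons0.
- rewrite ins_wedge; apply: (subspace_sum _ (altml_subspace R n m)) => i _.
  by apply: (subspaceZ _ (altml_subspace R n m)); apply: IH.
Qed.

Lemma exterior_exterior_wedge e m (s : 'I_m -> {scalar A}) :
  exterior e (exterior e (wedge s)) = 0.
Proof.
rewrite !exterior_wedge; apply/funext => f.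
rewrite /wedge; apply: (@determinant_alternate _ _ _ ord0 (lift ord0 ord0)) => // k.
by rewrite !mxE fconsS !fcons0.
Qed.

End Exterior.

(** * Wedge products of functionals that vanish on a subspace *)

Section RelativeDual.
Variables (R : realType) (n : nat) (K : set {mpoly R[n]}).
Local Notation A := {mpoly R[n]}.
Local Notation form := (Defs.form R n).
Hypothesis sK : subspace K.

(** The dual of [S_j / (K :&: S_j)], where [S_j] is the space of homogeneous
polynomials of degree [j]. *)
Definition relative_dual (j : nat) : set {scalar A} :=
  fun s => graded_dual j s /\ forall f, f \is j.-homog -> K f -> s f = 0.

Lemma relative_dual_homog i j s x :
  relative_dual j s -> x \is i.-homog -> i <> j -> s x = 0.
Proof. by case=> sj _ xi /eqP ij; apply: sj xi. Qed.

Definition weighted_wedges (w : int) m : set (form m) :=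
  fun c => exists (e : 'I_m -> nat) (s : 'I_m -> {scalar A}),
    [/\ forall i, e i <> 0%N,
        \sum_i ((e i)%:Z - 1) = w,
        forall i, relative_dual (e i) (s i)
      & c = wedge s].

(** In the expansion of a contracted wedge product, a factor of degree [e i]
survives only for an argument of degree [e i] outside [K], and removing it
lowers the weight accordingly. *)
Lemma weighted_wedge w m c : @weighted_wedges w m c -> weighted K w c.
Proof.
case=> e [s [e0 <- sT ->]] {w c}.
elim: m e s e0 sT => [|m IH] e s e0 sT; first by rewrite big_ord0.
move=> u x xu.
have sx0 i : u <> e i \/ K x -> s i x = 0.
  have [sE s0] := sT i; have [uE [//|Kx]|/eqP ne _] := eqVneq u (e i).
    by apply: s0 => //; rewrite -uE.
  by apply: sE xu; apply/eqP.
rewrite ins_wedge; split=> [ux|].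
  apply: big1 => i _; rewrite sx0 ?mulr0 ?scale0r //.
  by case: ux => [u0|]; [left; rewrite u0 => /esym/e0 | right].
apply: (subspace_sum _ (weighted_subspace _ _ _)) => i _.
have [uE|/eqP ne] := eqVneq u (e i); last first.
  rewrite sx0; last by left.
  by rewrite mulr0 scale0r; apply: (weighted_subspace _ _ _).1.
apply: (subspaceZ _ (weighted_subspace _ _ _)).
rewrite uE (bigD1_ord i) //= addrAC subrr add0r.
by apply: IH.
Qed.

(** Converts the multiplicities [k_j] of an admissible sequence to sums over
the factors of a wedge product. *)
Lemma sum_card_fibers (S : pzSemiRingType) m (e : 'I_m -> nat) (N : nat) (F : nat -> S) :
  (forall i, 0 < e i < N)%N ->
  \sum_(1 <= j < N) F j * #|[set i | e i == j]%SET|%:R = \sum_i F (e i).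
Proof.
move=> eN.
have E j : #|[set i | e i == j]%SET|%:R = \sum_i (e i == j)%:R :> S.
  rewrite -sum1dep_card natr_sum big_mkcond /=.
  by apply: eq_bigr => i _; case: eqP.
under eq_bigr => j _ do rewrite E mulr_sumr.
rewrite exchange_big; apply: eq_bigr => i _ /=.
rewrite (bigD1_seq (e i)) ?mem_index_iota ?iota_uniq //=.
rewrite eqxx mulr1 big1 ?addr0 // => j ji.
by rewrite eq_sym (negbTE ji) mulr0.
Qed.

Lemma cochains_weighted_wedges w m :
  @cochains R n relative_dual 1 m w = Defs.span (@weighted_wedges w m).
Proof.
rewrite /cochains; congr Defs.span; apply/funext => c; apply/propext; split.
  case=> k [k0 [N [kN _ <-]]] [e [s [kE sT ->]]].
  exists e, s; split=> // [i ei|].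
    have := kE 0%N; rewrite k0 => /eqP; rewrite cards_eq0 => /eqP/setP/(_ i).
    by rewrite !inE ei eqxx.
  rewrite -(@sum_card_fibers int _ e N (fun j => j%:Z - 1)).
    by apply: eq_bigr => j _; rewrite kE natz; congr (_ * _); lia.
  move=> i; have ki : (0 < k (e i))%N by rewrite -kE; apply/card_gt0P; exists i; rewrite inE.
  apply/andP; split; first by case: (e i) ki; rewrite ?k0.
  by rewrite ltnNge; apply/negP => /kN ki0; rewrite ki0 in ki.
case=> e [s [e0 wE sT ->]].
have eN i : (0 < e i < (\max_i e i).+1)%N.
  by rewrite ltnS leq_bigmax andbT lt0n; apply/eqP/e0.
exists (fun j => #|[set i | e i == j]%SET|); last by exists e, s; split.
split.
  by apply/eqP; rewrite cards_eq0; apply/eqP/setP => i; rewrite !inE; apply/eqP/e0.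
exists (\max_i e i).+1; split.
- move=> j jN; apply/eqP; rewrite cards_eq0; apply/eqP/setP => i; rewrite !inE.
  by apply/eqP => ej; have /andP[_] := eN i; rewrite ej ltnNge jN.
- have := @sum_card_fibers nat _ e _ (fun=> 1%N) eN.
  rewrite sum1_card card_ord; apply: etrans; apply: eq_bigr => j _.
  by rewrite natn; apply: esym (mul1n _).
- rewrite -wE -(@sum_card_fibers int _ e _ (fun j => j%:Z - 1) eN).
  by apply: eq_bigr => j _; rewrite natz; congr (_ * _); lia.
Qed.

Lemma scalar_pack (f : A -> R) : scalar f -> exists g : {scalar A}, forall x, g x = f x.
Proof.
move=> lin_f; pose g : {scalar A} :=
  HB.pack f (GRing.isLinear.Build R A R *%R f lin_f).
by exists g.
Qed.

(** A basis of the homogeneous polynomials of degree [j] modulo [K], with the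
dual basis, whose elements are extended by zero to the other degrees. *)
Lemma dual_basis j : exists d (tau : 'I_d -> {scalar A}) (v : 'I_d -> A),
  [/\ forall t, relative_dual j (tau t),
      forall t, v t \is j.-homog,
      forall t u, tau t (v u) = (t == u)%:R
    & forall z, z \is j.-homog -> K (z - \sum_t tau t z *: v t)].
Proof.
pose Z : set A := fun z => z \is j.-homog.
have sZ : subspace Z.
  by split=> [|a x y xZ yZ]; rewrite /Z ?rpred0 // rpredD // rpredZ.
pose ev (z : A) : 'rV[R]_#|{: 'X_{1..n < j.+1}}| := \row_i z@_(enum_val i : 'X_{1..n < j.+1}).
have lin_ev : linear ev.
  by move=> a x y; apply/rowP => i; rewrite !mxE mcoeffD mcoeffZ.
have ev_inj z : Z z -> ev z = 0 -> z = 0.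
  move=> zj z0; apply/mpolyP => m; rewrite mcoeff0.
  have [mj|mj] := eqVneq (mdeg m) j; last exact: dhomog_nemf_coeff zj mj.
  have lt : (mdeg m < j.+1)%N by rewrite mj.
  by have /rowP/(_ (enum_rank (BMultinom lt))) := z0; rewrite !mxE enum_rankK.
have [d [f [fZ fK surj]]] := quotient_dim_exists lin_ev sZ sK ev_inj.
(* f induces an injection modulo K, which makes coordinates unique. *)
have f_inj a b z : K (z - f a) -> K (z - f b) -> a = b.
  move=> Ka Kb; apply/eqP; rewrite -subr_eq0; apply/eqP/fK.
  have := subspaceB sK Kb Ka.
  by rewrite opprB addrC addrA subrK -linearB.
have /choice[g gE] : forall z, exists a, K (pihomog mdeg j z - f a).
  by move=> z; apply: surj; apply: pihomogP.
have g_lin : linear g.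
  move=> a x y; apply: f_inj (gE _) _.
  rewrite linearP /= [f _]linearP opprD addrACA -scalerBr.
  by case: sK => _; apply; apply: gE.
have gf a : g (f a) = a.
  apply: f_inj (gE _) _; rewrite pihomog_dE; last exact: fZ.
  by rewrite subrr; case: sK.
have g0 z : K (pihomog mdeg j z) -> g z = 0.
  by move=> Kz; apply: f_inj (gE _) _; rewrite linear0 subr0.
have /choice[tau tauE] : forall t, exists s : {scalar A}, forall z, s z = g z 0 t.
  by move=> t; apply: scalar_pack => a x y; rewrite g_lin !mxE.
exists d, tau, (fun t => f (delta_mx 0 t)); split=> [t|t|t u|z zj].
- split=> [i z ij zi|z zj Kz]; rewrite tauE g0 ?mxE //.
    by rewrite (pihomog_ne0 ij zi); case: sK.
  by rewrite pihomog_dE.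
- exact: fZ.
- by rewrite tauE gf mxE eqxx.
- rewrite (_ : \sum_t _ = f (g z)); last first.
    rewrite [g z in RHS]row_sum_delta linear_sum; apply: eq_bigr => t _.
    by rewrite linearZ tauE.
  by have := gE z; rewrite pihomog_dE.
Qed.

End RelativeDual.

(** * Expansion along dual bases *)

Section Frame.
Variables (R : realType) (n : nat).
Local Notation A := {mpoly R[n]}.
Local Notation form := (Defs.form R n).
Variables (I : finType) (tau : I -> {scalar A}) (v : I -> A).

(** The form only depends on the [tau]-coordinates of its arguments; the
condition is linear in the form and is inherited by all contractions, also by
those with inhomogeneous arguments, for which the weight is not defined. *)
Fixpoint framed {m} : form m -> Prop :=
  match m with
  | 0 => fun=> True
  | m'.+1 => fun c : form m'.+1 =>
      (forall x, ins x c = \sum_t tau t x *: ins (v t) c) /\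
      (forall x, framed (ins x c))
  end.

Lemma framed_comb (J : Type) (r : seq J) (a : J -> R) m (c : J -> form m) :
  (forall j, framed (c j)) -> framed (\sum_(j <- r) a j *: c j).
Proof.
elim: m c => // m IH c fc.
have insE x : ins x (\sum_(j <- r) a j *: c j) = \sum_(j <- r) a j *: ins x (c j).
  by rewrite linear_sum.
split=> [x|x]; last by rewrite insE; apply: IH => j; have [_ F] := fc j; apply: F.
rewrite insE; under [RHS]eq_bigr => t _ do rewrite insE scaler_sumr.
rewrite exchange_big; apply: eq_bigr => j _ /=.
have [-> _] := fc j; rewrite scaler_sumr; apply: eq_bigr => t _.
by rewrite !scalerA mulrC.
Qed.

Lemma framed_eq0 m (c : form m) :
  framed c -> (forall h : {ffun 'I_m -> I}, c (fun i => v (h i)) = 0) -> c = 0.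
Proof.
elim: m c => [|m IH] c.
  move=> _ c0; apply/funext => f.
  by rewrite [RHS](esym (c0 (ffun0 (card_ord 0)))); congr c; apply: form0_ext.
case=> cE cF c0; apply: form_ins_ext => x; rewrite cE linear0.
apply: big1 => t _; rewrite (IH (ins (v t) c) (cF (v t))) ?scaler0 // => h.
rewrite /ins -[RHS](c0 (finfun (fcons t h))); congr c; apply/funext => i.
rewrite ffunE; by case: (unliftP ord0 i) => [j|] ->; rewrite ?fcons0 ?fconsS.
Qed.

(** Euler's identity for the exterior algebra: contracting by [x] gives [c]
contracted once from [i_x (tau_t /\ _)], plus the identity for [i_x c]. *)
Lemma framed_euler m (c : form m.+1) : altml c -> framed c ->
  \sum_t exterior (tau t) (ins (v t) c) = m.+1%:R *: c.
Proof.
elim: m c => [|m IH] c cA [cE cF]; apply: form_ins_ext => x.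
  rewrite scale1r linear_sum [RHS]cE; apply: eq_bigr => t _ /=.
  exact: ins_exterior0.
rewrite linear_sum /=.
under eq_bigr => t _.
  rewrite ins_exterior (altml_swap _ _ cA) linearN opprK.
  over.
rewrite big_split /= -cE (IH _ (altml_ins x cA) (cF x)) linearZ /=.
by rewrite -{1}[ins x c]scale1r -scalerDl nat1r.
Qed.

End Frame.

(** * Intrinsic description of the cochains *)

Section RelativeCochains.
Variables (R : realType) (n : nat) (K : set {mpoly R[n]}).
Local Notation A := {mpoly R[n]}.
Local Notation form := (Defs.form R n).
Hypothesis sK : subspace K.

(** For weights at most [W], only the degrees [1], ..., [W + 1] matter:
constants are central, and an argument of higher degree would leave a form of
negative weight.  So finitely many dual bases suffice. *)
Lemma frame_exists (W : nat) :
  exists (I : finType) (deg : I -> nat) (tau : I -> {scalar A}) (v : I -> A),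
    (forall t, [/\ deg t <> 0%N, relative_dual K (deg t) (tau t)
                 & v t \is (deg t).-homog]) /\
    (forall w m (c : form m), w <= W%:Z -> altml c -> weighted K w c -> framed tau v c).
Proof.
have /choice[d /= dP] := dual_basis sK.
pose tau j := projT1 (cid (dP j)).
pose v j := projT1 (cid (projT2 (cid (dP j)))).
have basisP j : [/\ forall t, relative_dual K j (tau j t),
      forall t, v j t \is j.-homog,
      forall t u, tau j t (v j u) = (t == u)%:R
    & forall z, z \is j.-homog -> K (z - \sum_t tau j t z *: v j t)].
  by rewrite /v /tau; case: cid => t /= ?; case: cid.
(* The degree of an index is shifted by one, as degree 0 is excluded. *)
pose I : finType := {j : 'I_W.+1 & 'I_(d j.+1)}.
pose deg (t : {j : 'I_W.+1 & 'I_(d j.+1)}) := (tag t : 'I_W.+1).+1.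
exists I, deg, (fun t => tau (deg t) (tagged t)), (fun t => v (deg t) (tagged t)).
split=> [[j t]|w m c]; first by have [tauT vh _ _] := basisP j.+1; split.
elim: m w c => // m IH w c wW cA cw.
have [g gE] := altml_linear cA.
have cE x : ins x c = \sum_(t : I) tau (deg t) (tagged t) x *: ins (v (deg t) (tagged t)) c.
  have [h hE] : exists h : {linear A -> form m}, forall x,
      h x = \sum_(t : I) tau (deg t) (tagged t) x *: ins (v (deg t) (tagged t)) c.
    apply: linear_pack => a y z; rewrite scaler_sumr -big_split.
    by apply: eq_bigr => t _ /=; rewrite linearP scalerDl scalerA.
  rewrite gE -hE; apply: homog_ext => j {}x xj; rewrite -gE hE.
  have [j0|j0] := posnP j.
    rewrite (weighted_ins0 xj _ cw); last by left.
    rewrite big1 // => t _; have [tauT _ _ _] := basisP (deg t).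
    by rewrite (relative_dual_homog (tauT (tagged t)) xj) ?scale0r // j0.
  rewrite -(@sig_big_dep _ _ _ _ _ xpredT (fun=> xpredT)
    (fun (i : 'I_W.+1) (t : 'I_(d i.+1)) => tau i.+1 t x *: ins (v i.+1 t) c)) /=.
  have off i : i.+1 <> j -> \sum_t tau i.+1 t x *: ins (v i.+1 t) c = 0.
    move=> ij; apply: big1 => t _; have [tauT _ _ _] := basisP i.+1.
    by rewrite (relative_dual_homog (tauT t) xj) ?scale0r // => /esym.
  have [jW|jW] := leqP j W.+1; last first.
    rewrite [RHS]big1 => [|i _]; last by apply: off; have := ltn_ord i; lia.
    by apply: (weighted_lt0 (altml_ins x cA) (weighted_ins xj cw)); lia.
  case: j xj j0 jW off => // j xj _ jW off.
  rewrite (bigD1 (Ordinal jW)) //= [X in _ + X]big1 ?addr0; last first.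
    by move=> i ij; apply: off => -[ji]; move/eqP: ij; apply; apply: val_inj.
  have [_ vh _ /(_ _ xj) Kx] := basisP j.+1.
  have : ins (x - \sum_t tau j.+1 t x *: v j.+1 t) c = 0.
    apply: (weighted_ins0 (u := j.+1)) cw; last by right.
    by apply: rpredB => //; apply: rpred_sum => t _; apply: rpredZ; apply: vh.
  rewrite gE linearB linear_sum /= -gE => /eqP; rewrite subr_eq0 => /eqP ->.
  by apply: eq_bigr => t _; rewrite linearZ gE.
split=> // x; rewrite cE; apply: framed_comb => t.
have [_ vh _ _] := basisP (deg t).
apply: IH (altml_ins _ cA) (weighted_ins (vh _) cw).
have : (0 < deg t)%N by [].
move: (deg t) => k; lia.
Qed.

Lemma exterior_weighted_wedges j e w m (c : form m) :
  j <> 0%N -> relative_dual K j e -> Defs.span (@weighted_wedges R n K w m) c ->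
  Defs.span (@weighted_wedges R n K (w + (j%:Z - 1)) m.+1) (exterior e c).
Proof.
move=> j0 eT; have sS := span_subspace (@weighted_wedges R n K (w + (j%:Z - 1)) m.+1).
apply: (span_sub (U := fun c => Defs.span _ (exterior e c))).
  split=> [|a x y Sx Sy]; first by rewrite linear0; case: sS.
  by rewrite exterior_is_linear; case: sS => _; apply.
move=> {}c [ee [s [e0 <- sT ->]]]; apply: span_gen.
exists (fcons j ee), (fcons e s); split.
- by move=> i; case: (unliftP ord0 i) => [k|] ->; rewrite ?fcons0 ?fconsS.
- rewrite big_ord_recl fcons0 addrC; congr (_ + _).
  by apply: eq_bigr => i _; rewrite fconsS.
- by move=> i; case: (unliftP ord0 i) => [k|] ->; rewrite ?fcons0 ?fconsS.
- exact: exterior_wedge.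
Qed.

(** By induction, Euler's identity writes [c] as a combination of exterior
products of a functional [tau t] with the cochain [ins (v t) c], whose weight
is lower by that of [tau t]. *)
Lemma span_weighted_wedges w m (c : form m) :
  altml c -> weighted K w c -> Defs.span (@weighted_wedges R n K w m) c.
Proof.
elim: m w c => [|m IH] w c cA cw.
  have sS := span_subspace (@weighted_wedges R n K w 0).
  have [w0|/eqP w0] := eqVneq w 0; last by rewrite (cw w0); case: sS.
  pose s0 : 'I_0 -> {scalar A} := fun=> \0 : {scalar A}.
  have -> : c = c (fun=> 0) *: (wedge s0 : form 0).
    apply/funext => f; rewrite -[RHS]/(c (fun=> 0) * wedge s0 f) /wedge det_mx00 mulr1.
    by congr c; apply: form0_ext.
  apply: subspaceZ => //; apply: span_gen; exists (fun=> 1%N), s0.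
  by split=> [[]//||[]//|//]; rewrite big_ord0.
have [I [deg [tau [v [frameP /(_ w _ c _ cA cw) cF]]]]] := frame_exists `|w|%N.
have {}cF : framed tau v c by apply: cF; lia.
have -> : c = m.+1%:R^-1 *: \sum_t exterior (tau t) (ins (v t) c).
  by rewrite (framed_euler cA cF) scalerA mulVf ?scale1r // pnatr_eq0.
have sS := span_subspace (@weighted_wedges R n K w m.+1).
apply: subspaceZ => //; apply: subspace_sum => // t _; have [d0 tT vt] := frameP t.
have := IH _ _ (altml_ins (v t) cA) (weighted_ins vt cw).
by move/(exterior_weighted_wedges d0 tT); rewrite subrK.
Qed.

Lemma cochainsP w m (c : form m) :
  cochains (relative_dual K) 1 w c <-> altml c /\ weighted K w c.
Proof.
rewrite cochains_weighted_wedges; split=> [Sc|[]]; last exact: span_weighted_wedges.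
split; apply: span_sub Sc.
- exact: altml_subspace.
- by move=> {}c [e [s [_ _ _ ->]]]; apply: altml_wedge.
- exact: weighted_subspace.
- exact: weighted_wedge.
Qed.

(** A cochain is determined by its values on the finitely many tuples from a
frame, and these values vanish when a tuple has a repetition, which is
unavoidable in degrees beyond the size of the frame. *)
Lemma cochains_dim w : exists (d : nat -> nat) (N : nat),
  (forall m, cochain_dim (relative_dual K) 1 w m (d m)) /\
  (forall m, (N <= m)%N -> d m = 0%N).
Proof.
have [I [deg [tau [v [_ frameP]]]]] := frame_exists `|w|%N.
have cF m (c : form m) : cochains (relative_dual K) 1 w c -> framed tau v c.
  by move/cochainsP => [cA cw]; apply: frameP cA cw; lia.
have sC m := span_subspace (fun c : form m =>
  exists2 k, admissible 1 m w k & block (relative_dual K) k c).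
have /choice[d dP] : forall m, exists d, cochain_dim (relative_dual K) 1 w m d.
  move=> m; pose ev (c : form m) : 'rV[R]_#|{: {ffun 'I_m -> I}}| :=
    \row_k c (fun i => v ((enum_val k : {ffun 'I_m -> I}) i)).
  apply: (quotient_dim_exists (ev := ev)) => //.
  - by move=> a x y; apply/rowP => k; rewrite !mxE.
  - by split=> // a x y -> ->; rewrite scaler0 addr0.
  move=> c /cF fc c0; apply: (framed_eq0 fc) => h.
  by have /rowP/(_ (enum_rank h)) := c0; rewrite !mxE enum_rankK.
exists d, #|I|.+1; split=> // m Im.
suff C0 (c : form m) : cochains (relative_dual K) 1 w c -> c = 0.
  move: (dP m); rewrite /cochain_dim /subspace_dim.
  rewrite (_ : cochains _ _ _ = fun c : form m => c = 0); first exact: quotient_dim_eq0.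
  apply/funext => c; apply/propext; split=> [|->]; first exact: C0.
  by case: (sC m).
move=> Sc; apply: (framed_eq0 (cF _ _ Sc)) => h.
have [i [j [ij hij]]] : exists i j, i != j /\ h i = h j.
  have /injectivePn[i [j ij hij]] : ~~ injectiveb h.
    apply/injectiveP => /leq_card; rewrite card_ord; lia.
  by exists i, j.
move: Sc; rewrite cochains_weighted_wedges.
apply: (span_sub (U := fun c : form m => c (fun i => v (h i)) = 0)).
  by split=> // a x y x0 y0; rewrite formZD x0 y0 mulr0 addr0.
move=> {}c [e [s [_ _ _ ->]]]; apply: wedge_alternating ij _; by rewrite hij.
Qed.

End RelativeCochains.

(** * The Euler characteristic *)

Section EulerCharacteristic.
Variables (R : realType) (n : nat) (p : 'I_n -> 'I_n -> {mpoly R[n]}).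
Local Notation A := {mpoly R[n]}.
Local Notation form := (Defs.form R n).
Variable K : set A.
Hypothesis sK : subspace K.
Local Notation C w := (fun m => @cochains R n (relative_dual K) 1 m w).

Lemma cochains_subspace w m : subspace (C w m).
Proof. exact: span_subspace. Qed.

(** Degree one has weight zero, so that both exterior multiplication by [e] and
contraction by [x] preserve the weight. *)
Lemma exterior_acyclic (e : {scalar A}) (x : A) w :
  relative_dual K 1 e -> x \is 1.-homog -> e x = 1 ->
  [/\ forall m (c : form m), C w m c -> C w m.+1 (exterior e c),
      forall m (c : form m), C w m c -> exterior e (exterior e c) = 0
    & forall m, complex_cocycles (C w) (@exterior R n e) (m := m) =
                complex_coboundaries (C w) (@exterior R n e) (m := m)].
Proof.
move=> eT x1 ex.
have Cext m (c : form m) : C w m c -> C w m.+1 (exterior e c).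
  rewrite !cochains_weighted_wedges => /(exterior_weighted_wedges _ eT).
  by rewrite subrr addr0; apply.
have ext2 m (c : form m) : C w m c -> exterior e (exterior e c) = 0.
  apply: (span_sub (U := fun c : form m => exterior e (exterior e c) = 0)).
    split=> [|a y z y0 z0]; first by rewrite !linear0.
    by rewrite !exterior_is_linear y0 z0 scaler0 addr0.
  by move=> {}c [k _ [? [s [_ _ ->]]]]; apply: exterior_exterior_wedge.
split=> // -[|m]; apply/funext => c; apply/propext; split.
- by case=> _ /(congr1 (ins x)); rewrite ins_exterior0 ex scale1r.
- by move=> ->; split; [case: (cochains_subspace w 0) | rewrite linear0].
- case=> Cc /(congr1 (ins x)); rewrite ins_exterior ex scale1r linear0.
  move/eqP; rewrite subr_eq0 => /eqP cE; exists (ins x c) => //.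
  have /(cochainsP sK)[cA cw] := Cc; apply/(cochainsP sK); split; first exact: altml_ins.
  by have := weighted_ins x1 cw; rewrite subrr subr0.
- by case=> b Cb ->; split; [exact: Cext | exact: ext2].
Qed.

Hypothesis poisson_p : poisson_structure p.
Hypothesis linear_p : homogeneous_structure 1 p.
Hypothesis K_central : forall x y, K x -> bracket p x y = 0.

(** The dimensions of the cochain spaces appear in two complexes: the acyclic one
with differential [exterior e] forces their alternating sum to vanish, and the
one with the coboundary identifies this sum with the Euler characteristic of
the cohomology. *)
Lemma relative_euler_characteristic x w : x \is 1.-homog -> ~ K x ->
  alternating_sum_dim (cochain_dim (relative_dual K) 1 w) 0 /\
  alternating_sum_dim (cohomology_dim p (relative_dual K) 1 w) 0.
Proof.
move=> x1 Kx; have [d [N [dP dN]]] := cochains_dim sK w.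
have [e [y [eT y1 ey]]] : exists (e : {scalar A}) (y : A),
    [/\ relative_dual K 1 e, y \is 1.-homog & e y = 1].
  have [r [tau [v [tauT vh tauv /(_ _ x1) KE]]]] := dual_basis sK 1.
  case: r tau v tauT vh tauv KE => [|r] tau v tauT vh tauv KE.
    by case: Kx; rewrite big_ord0 subr0 in KE.
  by exists (tau ord0), (v ord0); rewrite tauv eqxx.
have [Cext ext2 exact_ext] := exterior_acyclic w eT y1 ey.
have [h [hP _ hE]] :=
  euler_poincare (@exterior_is_linear R n e) Cext ext2 dP dN.
have d_sum : \sum_(m < N) (-1) ^+ m * (d m)%:Z = 0.
  rewrite -hE; apply: big1 => m _; rewrite (_ : h m = 0%N) ?mulr0 //.
  have := hP m; rewrite exact_ext; apply: quotient_dim_eq0.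
  rewrite -exact_ext; split; last exact: linear0.
  by case: (cochains_subspace w m).
split; first by exists d, N.
have Cd m (c : form m) : C w m c -> C w m.+1 (coboundary p c).
  move=> /(cochainsP sK)[cA cw]; apply/(cochainsP sK); split.
    exact: altml_coboundary.
  exact: weighted_coboundary.
have d2 m (c : form m) : C w m c -> coboundary p (coboundary p c) = 0.
  by move=> /(cochainsP sK)[cA _]; apply: coboundary_coboundary.
have [b [bP bN bE]] := euler_poincare (@coboundary_is_linear R n p) Cd d2 dP dN.
by exists b, N; split; [case=> [|m]; apply: bP | | rewrite bE].
Qed.

End EulerCharacteristic.

Lemma graded_dualE (R : realType) (n : nat) :
  @graded_dual R n = relative_dual (fun f => f = 0).
Proof.
apply/funext => j; apply/funext => s; apply/propext; split=> [sj|[]//].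
by split=> // f _ ->; rewrite linear0.
Qed.

Lemma casimir_subspace (R : realType) (n : nat) (p : 'I_n -> 'I_n -> {mpoly R[n]}) :
  subspace (casimir p).
Proof.
split=> [g|a x y Cx Cy g].
  have [h hE] := linear_pack (@bracket_linearl R n p g).
  by rewrite -hE linear0.
by rewrite bracket_linearl Cx Cy scaler0 addr0.
Qed.

Lemma bracket_variables (R : realType) (n : nat) (p : 'I_n -> 'I_n -> {mpoly R[n]}) i j :
  bracket p 'X_i 'X_j = p i j.
Proof.
have dX k l : 'X_k^`M(l) = (k == l)%:R :> {mpoly R[n]}.
  rewrite mderivX mnm1E; case: eqP => [->|_]; last by rewrite scale0r.
  by rewrite scale1r (_ : (U_(l) - U_(l))%MM = 0%MM) ?mpolyX0 //;
    apply/mnmP => h; rewrite mnmBE mnm0E subnn.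
rewrite /bracket (bigD1 i) //= [X in _ + X]big1 ?addr0 => [|k ki]; last first.
  by apply: big1 => l _; rewrite dX eq_sym (negbTE ki) mulr0 mul0r.
rewrite (bigD1 j) //= [X in _ + X]big1 ?addr0 => [|k kj].
  by rewrite !dX !eqxx !mulr1.
by rewrite (dX j) eq_sym (negbTE kj) mulr0.
Qed.

Theorem theorem8p2 (R : realType) (n : nat) (p : 'I_n -> 'I_n -> {mpoly R[n]}) :
  poisson_structure p ->
  homogeneous_structure 1 p ->
  nontrivial_structure p ->
  forall w : int,
    (alternating_sum_dim (cochain_dim (@graded_dual R n) 1 w) 0 /\
     alternating_sum_dim (cohomology_dim p (@graded_dual R n) 1 w) 0) /\
    (alternating_sum_dim (cochain_dim (reduced_dual p) 1 w) 0 /\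
     alternating_sum_dim (cohomology_dim p (reduced_dual p) 1 w) 0).
Proof.
move=> pP p1 [i [j pij]] w.
have Xi : ~ casimir p 'X_i.
  by move=> /(_ 'X_j) /eqP; rewrite bracket_variables (negbTE pij).
have Xi1 : ('X_i : {mpoly R[n]}) \is 1.-homog by rewrite dhomogX /= mdeg1.
have [c0 cZD] := casimir_subspace p.
split; last first.
  apply: (relative_euler_characteristic (casimir_subspace p) pP p1 _ w Xi1 Xi).
  by move=> x y; apply.
rewrite graded_dualE; apply: (relative_euler_characteristic _ pP p1 _ w Xi1).
- by split=> // a x y -> ->; rewrite scaler0 addr0.
- by move=> x y ->; apply: c0.
- by move=> X0; apply: Xi; rewrite X0.
Qed.
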